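(* Let $X=\{0,1\}$ and let $\phi_{0},\phi_{1}:X^{\omega}\to X^{\omega}$, $\phi_{\alpha}(x)=\alpha x$, be the standard iterated function system of the Cantor set $X^{\omega}$, with standard distance $d$. Consider, for a dilatation structure $(X^{\omega},d,\delta)$, the relations $$\delta_{2}^{(0)}x=\phi_{0}(x)=0x,\qquad \delta_{2}^{(1)}x=\phi_{1}(x)=1x\qquad\text{for all }x\in X^{\omega},\qquad(1)$$ $$\delta^{(q)}_{2^{n}}x=qx\qquad\text{for all } n\in\mathbb{N}^{*},\ q\in X^{n},\ x\in X^{\omega},\qquad(2)$$ where $(q)=qqqq\dots\in X^{\omega}$. Then the standard iterated function system of the Cantor set does not uniquely determine a linear and self-similar dilatation structure satisfying (1) and (2) (that is, there is more than one such dilatation structure). There exist two different and non-equivalent strong linear dilatation structures on $(X^{\omega},d)$ which satisfy (1) and (2).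
   Context: Words. $X=\{0,1\}$, $\bar 0=1$, $\bar 1=0$; $\mathbb{N}=\{0,1,2,\dots\}$, $\mathbb{N}^{*}=\{1,2,\dots\}$. $X^{n}$ is the set of words of length $n$; $X^{\omega}$ is the set of infinite words $w=w_{1}w_{2}\dots$. Juxtaposition is concatenation. The standard ultrametric is $d(x,y)=2^{-m}$ for $x\neq y$, where $m$ is the length of the longest common prefix of $x,y$, and $d(x,x)=0$; $X^\omega$ is compact of diameter $1$. Dilatations. $\Gamma=\{2^{p}: p\in\mathbb{Z}\}$ is the discrete multiplicative group of powers of $2$ seen as dyadic numbers, with $\nu(2^{p})=2^{-p}$; thus ''$\varepsilon\to 0$'' means $\varepsilon=2^{p}$, $p\to+\infty$. A weak dilatation structure $(X^{\omega},d,\delta)$ consists, for each $x\in X^{\omega}$, of maps $\delta^{x}_{2^{p}}:X^{\omega}\to V_{2^{p}}(x)$ for $p\ge 0$ and $\delta^{x}_{2^{-p}}:W_{2^{-p}}(x)\to X^{\omega}$ for $p\geq 1$, with $V_{2^{p}}(x), W_{2^{-p}}(x)\subset X^{\omega}$ open, satisfying: A0. Each $\delta^{x}_{2^{p}}$, $p\ge 0$, is a homeomorphism, and $\{y: d(x,y)\le 2^{-p}\}\subset \delta^{x}_{2^{p}}X^{\omega}\subset V_{2^{p}}(x)$. For $p\ge1$, $\delta^{x}_{2^{-p}}$ is injective and invertible on its image, $V_{2^{p}}(x)\subset W_{2^{-p}}(x)$, and $\delta^{x}_{2^{-p}}\delta^{x}_{2^{p}}u=u$ for all $u$. There are $R>0$,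 $p_1\in\mathbb{N}$ such that $\delta^{x}_{2^{p}}v\in W_{2^{-p}}(\delta^{x}_{2^{p}}u)$ whenever $d(x,u),d(x,v)\le R$ and $p\ge p_1$. A1. $\delta^{x}_{\varepsilon}x=x$, $\delta^{x}_{1}=\mathrm{id}$; the map $(\varepsilon,x,y)\mapsto\delta^{x}_{\varepsilon}y$ is continuous on its domain $\mathrm{dom}\,\delta\subset\Gamma\times X^{\omega}\times X^{\omega}$, and extends continuously to the closure of $\mathrm{dom}\,\delta$ in $(\Gamma\cup\{0\})\times X^{\omega}\times X^{\omega}$, with $\lim_{p\to\infty}\delta^{x}_{2^{p}}y=x$. A2. $\delta^{x}_{2^{p}}\delta^{x}_{2^{r}}u=\delta^{x}_{2^{p+r}}u$ for all $p,r\ge0$ and $x,u\in X^\omega$. A3. For each $x$ there is a function $d^{x}$ on $X^{\omega}\times X^{\omega}$ with $\lim_{p\to\infty}2^{p}d(\delta^{x}_{2^{p}}u,\delta^{x}_{2^{p}}v)=d^{x}(u,v)$ uniformly in $x,u,v$; moreover $d^{x}$ is non-degenerate: $d^{x}(u,v)=0$ implies $u=v$. A weak dilatation structure is a dilatation structure (also called strong dilatation structure) if in addition A4 holds: $\Delta^{x}_{2^p}(u,v):=\delta_{2^{-p}}^{\delta^{x}_{2^{p}}u}\,\delta^{x}_{2^{p}}v$ converges as $p\to\infty$, uniformly in $x$ and in $u,v$ with $d(x,u),d(x,v)\le R$. Linear: all dilatations are linear transformations; a transformation $A:X^\omega\to X^\omega$ is linear if it is Lipschitz and $A\,\delta^{y}_{\mu}v=\delta^{A(y)}_{\mu}A(v)$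 for all $y,v\in X^\omega$ and $\mu\in\Gamma$, $\nu(\mu)<1$. So linearity gives $\delta_{\varepsilon}^{x}\delta_{\mu}^{y}v=\delta_{\mu}^{\delta_{\varepsilon}^{x}y}\delta_{\varepsilon}^{x}v$ for $x,y,v\in X^{\omega}$ and $\varepsilon=2^{p},\mu=2^{r}$, $p,r\geq 0$. Self-similar: $\delta_{2}^{\alpha x}\,\alpha y=\alpha\,\delta_{2}^{x}y$ for all $\alpha\in X$, $x,y\in X^{\omega}$. Equivalence: dilatation structures $(X^{\omega},\delta,d)$ and $(X^{\omega},\bar\delta,\bar d)$ are equivalent if the identity $(X^{\omega},d)\to(X^{\omega},\bar d)$ is bilipschitz and for any $x$ there are functions $P^{x},Q^{x}$ (defined for $u\in X^\omega$ sufficiently close to $x$) with $\lim_{p\to\infty}2^{p}\,\bar d(\delta^{x}_{2^{p}}u,\bar\delta^{x}_{2^{p}}Q^{x}(u))=0$ and $\lim_{p\to\infty}2^{p}\,d(\bar\delta^{x}_{2^{p}}u,\delta^{x}_{2^{p}}P^{x}(u))=0$, uniformly with respect to $x,u$ in compact sets. *)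

(* Defs.v *)
From HB Require Import structures.
From mathcomp Require Import all_boot all_order all_algebra.
From mathcomp Require Import all_classical all_reals all_analysis.

Set Implicit Arguments.
Unset Strict Implicit.
Unset Printing Implicit Defensive.

Import Order.TTheory GRing.Theory Num.Theory.
Import numFieldNormedType.Exports.

Local Open Scope classical_set_scope.
Local Open Scope ring_scope.

(* X = {0,1} is bool (0 = false, 1 = true).  The letter w_(n+1) of an infinite
   word w is w n.  The parameter R is only there to let the canonical metric
   structure on words take its values in R. *)
Definition omega (R : realType) : Type := nat -> bool.

HB.instance Definition _ (R : realType) := Pointed.copy (omega R) (nat -> bool).

Section Metric.
Context {R : realType}.
Implicit Types x y z : omega R.

(* ex_minn h is the first index at which x and y differ, that is, the length of
   their longest common prefix. *)
Definition dist x y : R :=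
  if pselect (exists n, x n != y n) is left h then 2^-1 ^+ ex_minn h else 0.

Lemma dist_leP x y (m : nat) :
  dist x y <= 2^-1 ^+ m <-> forall i, (i < m)%N -> x i = y i.
Proof.
rewrite /dist; case: pselect => [h|nh]; last first.
  split=> [_ i _|_]; last by rewrite exprn_ge0 // invr_ge0.
  by apply/eqP/negPn/negP => xy; apply: nh; exists i.
case: ex_minnP => n nxy nmin.
rewrite ler_iXn2l ?invr_gt0 ?invf_lt1 ?ltr1n //.
split=> [mn i im|xy].
  by apply/eqP/negPn/negP => /nmin; rewrite leqNgt (leq_trans im mn).
by rewrite leqNgt; apply/negP => /xy /eqP; rewrite (negPf nxy).
Qed.

Lemma dist_xx x : dist x x = 0.
Proof.
by rewrite /dist; case: pselect => // h; exfalso; case: h => n; rewrite eqxx.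
Qed.

Lemma dist_eq0 x y : dist x y = 0 -> x = y.
Proof.
move=> xy; apply/funext => i.
apply: (dist_leP x y i.+1).1 => //.
by rewrite xy exprn_ge0 // invr_ge0.
Qed.

Lemma dist_le_sym x y : dist x y <= dist y x.
Proof.
rewrite {2}/dist; case: pselect => [h|nh]; last first.
  suff -> : x = y by rewrite dist_xx.
  by apply/funext => i; apply/eqP/negPn/negP; rewrite eq_sym => xy; apply: nh; exists i.
apply/dist_leP => i; case: ex_minnP => n _ nmin lt_in.
by apply/eqP/negPn/negP; rewrite eq_sym => /nmin; rewrite leqNgt lt_in.
Qed.

Lemma dist_sym x y : dist x y = dist y x.
Proof. by apply/eqP; rewrite eq_le !dist_le_sym. Qed.

Lemma dist_cases x y : dist x y = 0 \/ exists m : nat, dist x y = 2^-1 ^+ m.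
Proof.
by rewrite /dist; case: pselect => [h|nh]; [right; eexists | left].
Qed.

Lemma dist_ge0 x y : 0 <= dist x y.
Proof.
by case: (dist_cases x y) => [->|[m ->]] //; rewrite exprn_ge0 // invr_ge0.
Qed.

Lemma dist_ultra y x z : dist x z <= Num.max (dist x y) (dist y z).
Proof.
wlog le_yz : x z / dist y z <= dist x y => [hw|].
  case/orP: (le_total (dist y z) (dist x y)) => [|le_xy]; first exact: hw.
  rewrite (dist_sym x z) maxC (dist_sym y z) (dist_sym x y); apply: hw.
  by rewrite dist_sym (dist_sym z).
rewrite max_l //; case: (dist_cases x y) => [xy|[m xy]].
  by move: le_yz; rewrite xy => yz; rewrite (dist_eq0 xy).
move: le_yz; rewrite xy => /dist_leP yz; apply/dist_leP => i im.
have/dist_leP -> // : dist x y <= 2^-1 ^+ m by rewrite xy.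
exact: yz.
Qed.

Lemma dist_triangle y x z : dist x z <= dist x y + dist y z.
Proof.
apply: le_trans (dist_ultra y x z) _.
by rewrite ge_max lerDl lerDr !dist_ge0.
Qed.

End Metric.

HB.instance Definition _ (R : realType) :=
  isMetric.Build R (omega R)
    (@dist_xx R) (@dist_eq0 R) (@dist_sym R) (@dist_triangle R).

Definition prepend {R : realType} (q : seq bool) (x : omega R) : omega R :=
  fun n => if (n < size q)%N then nth false q n else x (n - size q)%N.

(* The word (q) = qqqq..., for q nonempty. *)
Definition periodic {R : realType} (q : seq bool) : omega R :=
  fun n => nth false q (n %% size q).

(* Gamma is encoded by exponents: e : int stands for 2^e, and nu (2^e) = 2^(-e).
   In Gamma U {0}, None is 0; the topology is the one given by the absolute
   value nu: it is discrete on Gamma, and Some e tends to None when e tends to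
   +oo, not to -oo. *)
Definition nu {R : realType} (e : int) : R := 2 ^ (- e).

Definition nu0 {R : realType} (t : option int) : R :=
  if t is Some e then nu e else 0.

Definition Gamma0 (R : realType) : Type := @initial_topology (option int) R nu0.

HB.instance Definition _ (R : realType) :=
  Topological.copy (Gamma0 R) (@initial_topology (option int) R nu0).

Section Dilatations.
Context {R : realType}.
Local Notation X := (omega R).

(* dil D e x is delta^x_(2^e), a total function whose values for e < 0 matter
   only on domW D (- e) x; domV D p x is V_(2^p)(x), and domW D p x is
   W_(2^(-p))(x), which matters only for p >= 1. *)
Record dilatation := Dilatation {
  dil :> int -> X -> X -> X;
  domV : nat -> X -> set X;
  domW : nat -> X -> set X }.

Implicit Types D : dilatation.

Definition homeo_on_image (f : X -> X) : Prop :=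
  continuous f /\
  exists2 g : X -> X, cancel f g & {within range f, continuous g}.

Definition axiomA0 D (rho : R) (p1 : nat) : Prop :=
  [/\ forall (p : nat) x, open (domV D p x),
      forall (p : nat) x, (0 < p)%N -> open (domW D p x),
      forall (p : nat) x,
        [/\ homeo_on_image (D p%:Z x),
            [set y | dist x y <= 2^-1 ^+ p] `<=` range (D p%:Z x)
          & range (D p%:Z x) `<=` domV D p x],
      forall (p : nat) x, (0 < p)%N ->
        [/\ set_inj (domW D p x) (D (- p%:Z) x),
            domV D p x `<=` domW D p x
          & forall u, D (- p%:Z) x (D p%:Z x u) = u]
    & 0 < rho /\
      forall (p : nat) x u v, (0 < p)%N -> (p1 <= p)%N ->
        dist x u <= rho -> dist x v <= rho ->
        domW D p (D p%:Z x u) (D p%:Z x v)].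

Definition dom D : set (Gamma0 R * X * X) :=
  [set t | exists2 e : int, t.1.1 = Some e
           & 0 <= e \/ domW D `|e|%N t.1.2 t.2].

(* The value at None is immaterial: dom D has no point (None, x, y). *)
Definition dil_map D (t : Gamma0 R * X * X) : X :=
  if t.1.1 is Some e then D e t.1.2 t.2 else t.1.2.

Definition axiomA1 D : Prop :=
  [/\ forall (e : int) x, D e x x = x,
      forall x y, D 0 x y = y,
      {within dom D, continuous (dil_map D)},
      exists2 F : Gamma0 R * X * X -> X,
        {within closure (dom D), continuous F}
        & forall t, dom D t -> F t = dil_map D t
    & forall x y, (fun p : nat => D p%:Z x y) @ \oo --> x].

Definition axiomA2 D : Prop :=
  forall (p r : nat) x u, D p%:Z x (D r%:Z x u) = D (p + r)%N%:Z x u.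

Definition axiomA3 D : Prop :=
  exists dx : X -> X -> X -> R,
    {uniform, (fun (p : nat) (t : X * X * X) =>
        2 ^+ p * dist (D p%:Z t.1.1 t.1.2) (D p%:Z t.1.1 t.2)) @ \oo -->
      (fun t => dx t.1.1 t.1.2 t.2)} /\
    forall x u v, dx x u v = 0 -> u = v.

Definition Delta D (p : nat) (x u v : X) : X :=
  D (- p%:Z) (D p%:Z x u) (D p%:Z x v).

Definition axiomA4 D (rho : R) : Prop :=
  exists L : X -> X -> X -> X,
    {uniform [set t : X * X * X |
               dist t.1.1 t.1.2 <= rho /\ dist t.1.1 t.2 <= rho],
      (fun (p : nat) (t : X * X * X) => Delta D p t.1.1 t.1.2 t.2) @ \oo -->
      (fun t => L t.1.1 t.1.2 t.2)}.

Definition weak_dilatation_structure D (rho : R) (p1 : nat) : Prop :=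
  [/\ axiomA0 D rho p1, axiomA1 D, axiomA2 D & axiomA3 D].

(* The radius rho of A4 is the one of A0. *)
Definition dilatation_structure D : Prop :=
  exists (rho : R) (p1 : nat),
    weak_dilatation_structure D rho p1 /\ axiomA4 D rho.

Definition linear_transformation D (A : X -> X) : Prop :=
  (exists C : R, forall x y, dist (A x) (A y) <= C * dist x y) /\
  forall (e : int) y v, (nu e : R) < 1 -> A (D e y v) = D e (A y) (A v).

(* The dilatations that are transformations of the whole space are those of
   coefficient 2^p with p >= 0. *)
Definition linear_dilatations D : Prop :=
  forall (p : nat) x, linear_transformation D (D p%:Z x).

Definition self_similar D : Prop :=
  forall (a : bool) x y,
    D 1 (prepend [:: a] x) (prepend [:: a] y) = prepend [:: a] (D 1 x y).

(* Equality as families of dilatations: V, W and the values of the inverse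
   dilatations outside the images of the dilatations do not count. *)
Definition same_dilatations D D' : Prop :=
  forall (p : nat) x u, D p%:Z x u = D' p%:Z x u.

Definition bilipschitz (d d' : X -> X -> R) : Prop :=
  exists c C : R, [/\ 0 < c, 0 < C &
    forall x y, c * d x y <= d' x y /\ d' x y <= C * d x y].

(* There are functions Q x, defined on a neighbourhood U x of x, such that
   2^p d(D_(2^p)^x u, D'_(2^p)^x (Q x u)) tends to 0, uniformly for (x, u) in
   the compact subsets of the domain of Q. *)
Definition approximable (d : X -> X -> R) D D' : Prop :=
  exists (U : X -> set X) (Q : X -> X -> X),
    (forall x, nbhs x (U x)) /\
    forall K : set (X * X), compact K -> K `<=` [set t | U t.1 t.2] ->
      {uniform K, (fun (p : nat) (t : X * X) =>
          2 ^+ p * d (D p%:Z t.1 t.2) (D' p%:Z t.1 (Q t.1 t.2))) @ \oo -->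
        (fun=> 0)}.

Definition equivalent_dilatations
    (d : X -> X -> R) D (d' : X -> X -> R) D' : Prop :=
  [/\ bilipschitz d d', approximable d' D D' & approximable d D' D].

Definition induces_ifs D : Prop :=
  (forall x, D 1 (periodic [:: false]) x = prepend [:: false] x) /\
  (forall x, D 1 (periodic [:: true]) x = prepend [:: true] x).

Definition induces_words D : Prop :=
  forall (n : nat) (q : n.-tuple bool) x, (0 < n)%N ->
    D n%:Z (periodic q) x = prepend q x.

End Dilatations.

Arguments dilatation : clear implicits.

(* Main.v *)
Require Import Defs.
From HB Require Import structures.
From mathcomp Require Import all_boot all_order all_algebra.
From mathcomp Require Import all_classical all_reals all_analysis.
From mathcomp Require Import zify.

(** Infinite binary words carry two natural group laws: the 2-adic integers,
    where a word is the sum of its digits times powers of 2 and digits are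
    added with carries, and the power series over the field with two elements,
    where digits are added without carries.  In both of them the zero is the
    word 000..., and prefixing a letter a is x |-> a000... + S x, where S
    (multiplication by 2, respectively by the variable) is the right shift
    ([wadd_prepend]).

    For such a group law put delta^x_(2^p) y = x + S^p (y - x).  Translations
    are isometries and S divides distances by 2, because x and y agree on their
    first m letters exactly when y lies in x + S^m X ([agree_addP]).  The axioms
    then reduce to identities between group elements.  The rescaled distance
    2^p d (delta^x_(2^p) u, delta^x_(2^p) v) is d (u, v) for every p, the
    difference Delta^x_(2^p) (u, v) is delta^x_(2^p) u + (v - u), which tends to
    x + (v - u), and linearity and self-similarity hold since S is additive.
    The periodic word (q) solves (q) = q000... + S^n (q), hence
    delta^(q)_(2^n) x = (q) + S^n (x - (q)) = q000... + S^n x = q x.  So both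
    groups give structures that induce the iterated function system, which
    prescribes the dilatations only at periodic base points
    ([homothety_properties]).

    The two structures are not equivalent, because a carry depends on the base
    point.  Let x = 0101... and let u = x + 2^k in the 2-adic sense.  The 2-adic
    dilatation sends u to x + 2^(p+k), whose letter of index p+k+1 is the sum
    mod 2 of the letters of x of indices p+k and p+k+1, hence 1 for every p.
    The power series dilatation sends any candidate v to a word whose letter of
    index p+k+1 is the same letter of x plus a constant independent of p, so it
    alternates with p ([bumped_inapproximable]).  For one p out of two the
    images of u and v are therefore at distance at least 2^(-(p+k+1)), while u
    is as close to x as desired if k is large. *)

Set Implicit Arguments.
Unset Strict Implicit.
Unset Printing Implicit Defensive.

Import Order.TTheory GRing.Theory Num.Theory.
Import numFieldNormedType.Exports.

Local Open Scope classical_set_scope.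
Local Open Scope ring_scope.

(** * Words, shifts and common prefixes *)

Section Words.
Context {R : realType}.
Local Notation X := (omega R).
Implicit Types (x y z : X) (q : seq bool).

Definition agree (m : nat) x y := forall i, (i < m)%N -> x i = y i.

Definition shift (n : nat) x : X := prepend (nseq n false) x.

Definition tail (n : nat) x : X := fun i => x (i + n)%N.

Definition zero_word : X := fun=> false.

Lemma agree_sym m x y : agree m x y -> agree m y x.
Proof. by move=> xy i /xy. Qed.

Lemma agree_trans m y x z : agree m x y -> agree m y z -> agree m x z.
Proof. by move=> xy yz i im; rewrite xy ?yz. Qed.

Lemma agreeW m n x y : (m <= n)%N -> agree n x y -> agree m x y.
Proof. by move=> mn xy i im; apply: xy; exact: leq_trans im mn. Qed.

Lemma prepend_ge q x i : prepend q x (i + size q)%N = x i.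
Proof. by rewrite /prepend ltnNge leq_addl /= addnK. Qed.

Lemma prepend0 x : prepend [::] x = x.
Proof. by apply/funext => i; rewrite /prepend /= subn0. Qed.

Lemma prepend_cat q q' x : prepend (q ++ q') x = prepend q (prepend q' x).
Proof.
apply/funext => i; rewrite /prepend size_cat nth_cat subnDA.
case: (ltnP i (size q)) => [iq|qi]; first by rewrite ltn_addr.
by rewrite ltn_subLR.
Qed.

Lemma shift0 x : shift 0 x = x.
Proof. exact: prepend0. Qed.

Lemma shift_shift m n x : shift m (shift n x) = shift (m + n) x.
Proof. by rewrite /shift -prepend_cat nseqD. Qed.

Lemma shift_zero n : shift n zero_word = zero_word.
Proof.
apply/funext => i; rewrite /shift /prepend size_nseq nth_nseq.
by case: (i < n)%N; rewrite ?if_same.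
Qed.

Lemma shift_tailK n x : tail n (shift n x) = x.
Proof.
by apply/funext => i; have := prepend_ge (nseq n false) x i; rewrite size_nseq.
Qed.

Lemma prepend_mkseq m x : prepend (mkseq x m) (tail m x) = x.
Proof.
apply/funext => i; rewrite /prepend size_mkseq /tail.
by case: ltnP => im; rewrite ?nth_mkseq ?subnK.
Qed.

Lemma agree_prepend q x y : agree (size q) (prepend q x) (prepend q y).
Proof. by move=> i iq; rewrite /prepend iq. Qed.

Lemma agree_mkseq m x y : agree m x y -> mkseq x m = mkseq y m.
Proof.
move=> xy; apply: (@eq_from_nth _ false); rewrite ?size_mkseq // => i im.
by rewrite !nth_mkseq ?xy.
Qed.

Lemma agree_tail m n x y : agree (m + n) x y -> agree m (tail n x) (tail n y).
Proof. by move=> xy i im; apply: xy; rewrite ltn_add2r. Qed.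

Lemma agree_shift m n x y :
  agree (m + n) (shift n x) (shift n y) <-> agree m x y.
Proof.
split=> [/agree_tail|xy i im]; first by rewrite !shift_tailK.
rewrite /shift /prepend size_nseq; case: ltnP => // ni.
by apply: xy; rewrite ltn_subLR // addnC.
Qed.

Lemma periodicE q :
  (0 < size q)%N -> @Defs.periodic R q = prepend q (Defs.periodic q).
Proof.
move=> q0; apply/funext => i; rewrite /Defs.periodic /prepend.
case: ltnP => [/modn_small -> //|qi].
by rewrite -[in LHS](subnK qi) modnDr.
Qed.

Lemma distP m x y : dist x y <= 2^-1 ^+ m <-> agree m x y.
Proof. exact: dist_leP. Qed.

(** The distance takes only the values 0 and 2^(-k), so a strict bound gives one
    more common letter than the large one. *)
Lemma dist_lt_agree m x y : dist x y < 2^-1 ^+ m -> agree m.+1 x y.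
Proof.
have [/dist_eq0 -> //|[k xy]] := dist_cases x y.
rewrite xy ltr_iXn2l ?invr_gt0 ?invf_lt1 ?ltr1n // => mk.
by apply/(agreeW mk)/distP; rewrite xy.
Qed.

Lemma le_dist x y x' y' :
  (forall m, agree m x' y' -> agree m x y) -> dist x y <= dist x' y'.
Proof.
have [/dist_eq0 -> xy|[m xy'] xy] := dist_cases x' y'.
  have -> : x = y by apply/funext => i; exact: (xy i.+1).
  by rewrite !dist_xx.
by rewrite xy'; apply/distP/xy/distP; rewrite xy'.
Qed.

Lemma eq_dist x y x' y' :
  (forall m, agree m x y <-> agree m x' y') -> dist x y = dist x' y'.
Proof. by move=> xy; apply/le_anti/andP; split; apply: le_dist => m /xy. Qed.

Lemma dist_shift n x y : dist (shift n x) (shift n y) = 2^-1 ^+ n * dist x y.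
Proof.
have [xy|[m xy]] := dist_cases x y.
  by rewrite xy (dist_eq0 xy) dist_xx mulr0.
apply/le_anti; rewrite xy -exprD addnC; apply/andP; split.
  by apply/distP/agree_shift/distP; rewrite xy.
rewrite leNgt; apply/negP => /dist_lt_agree.
rewrite -addSn => /agree_shift/distP; rewrite xy leNgt.
by rewrite ltr_iXn2l ?invr_gt0 ?invf_lt1 ?ltr1n // ltnS leqnn.
Qed.

Lemma pow_half_lt (e : R) : 0 < e -> exists m : nat, 2^-1 ^+ m < e.
Proof.
move=> e0; have [m _ /(_ m (leqnn m))] := near_infty_natSinv_expn_lt (PosNum e0).
by rewrite /= div1r -exprVn; exists m.
Qed.

(** Common prefixes, rather than balls, are used as the base of the uniformity
    and of the topology: all the maps below are compatible with them. *)
Lemma entourage_agree (E : set (X * X)) :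
  entourage E -> exists m, forall x y, agree m x y -> E (x, y).
Proof.
rewrite -entourage_ballE => -[e /= e0 sE].
have [m me] := pow_half_lt e0; exists m => x y /distP xy.
by apply: sE; rewrite /= ballEmdist /=; exact: le_lt_trans xy me.
Qed.

Lemma nbhs_agree x (A : set X) :
  nbhs x A <-> exists m, forall y, agree m x y -> A y.
Proof.
split=> [|[m mA]].
  rewrite -nbhs_entourageE => -[E /entourage_agree[m mE] EA].
  by exists m => y /mE xy; apply: EA; rewrite /= /xsection /= inE.
apply/nbhs_ballP; exists (2^-1 ^+ m) => /=; first by rewrite exprn_gt0 ?invr_gt0.
by move=> y; rewrite ballEmdist => /ltW/distP; exact: mA.
Qed.

End Words.

(** * Neighbourhoods in the scale group *)

Section Gamma0.
Context {R : realType}.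

Lemma nbhs_nu0 (t : Gamma0 R) (B : set R) :
  nbhs (nu0 t) B -> nbhs t (nu0 @^-1` B).
Proof. exact: (@initial_continuous (option int) R nu0 t B). Qed.

Lemma Gamma0_near0 (c : R) : 0 < c ->
  nbhs (None : Gamma0 R) [set t | nu0 t < c].
Proof.
by move=> c0; apply: (@nbhs_nu0 None [set r | r < c]); exact: lt_nbhsl.
Qed.

(** No value of nu lies strictly between half of nu e and twice nu e except nu e
    itself, and nu0 vanishes at the added point. *)
Lemma Gamma0_isolated (e : int) : nbhs (Some e : Gamma0 R) [set Some e].
Proof.
have two : (1 : R) < 2 by rewrite ltr1n.
have : nbhs (@nu R e)
    ([set r | 2 ^ (- e - 1) < r] `&` [set r | r < 2 ^ (- e + 1)]).
  apply: filterI.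
    by apply: lt_nbhsr; rewrite ltr_eXz2l // ltrBlDr ltrDl.
  by apply: lt_nbhsl; rewrite ltr_eXz2l // ltrDl.
move/(@nbhs_nu0 (Some e)); apply: filterS => -[e'|] [/=]; last first.
  by rewrite ltNge exprz_ge0 //= ler0n.
by rewrite !ltr_eXz2l // => ee' e'e; congr Some; lia.
Qed.

End Gamma0.

(** * Homotheties of a group of words *)

Declare Scope word_scope.

Section WordGroup.
Context {R : realType}.
Local Notation X := (omega R).

(** Subtraction is primitive, since opposites never occur alone.  The last law
    at x = 0 says that a word is its first letter plus the shift of the
    remaining word; at a = 0 it makes the shift additive. *)
Record word_group := WordGroup {
  wadd : X -> X -> X;
  wsub : X -> X -> X;
  waddA : associative wadd;
  waddC : commutative wadd;
  wadd0 : right_id zero_word wadd;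
  waddK : forall x y, wsub (wadd x y) y = x;
  wsubK : forall x y, wadd (wsub x y) y = x;
  wadd_prepend : forall a x y,
    prepend [:: a] (wadd x y) = wadd (prepend [:: a] x) (shift 1 y) }.

Variable G : word_group.
Implicit Types (x y z u v w : X) (q : seq bool) (n m p r : nat).

Local Notation "x + y" := (wadd G x y) : word_scope.
Local Notation "x - y" := (wsub G x y) : word_scope.
Local Open Scope word_scope.

Lemma waddCA x y z : x + (y + z) = y + (x + z).
Proof. by rewrite !waddA (waddC G x y). Qed.

Lemma waddACA x y z w : (x + y) + (z + w) = (x + z) + (y + w).
Proof. by rewrite -!waddA (waddCA y). Qed.

Lemma wsub_eq x y z : x + y = z -> z - y = x.
Proof. by move=> <-; rewrite waddK. Qed.

Lemma waddKl x y : (x + y) - x = y.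
Proof. by rewrite waddC waddK. Qed.

Lemma wsubKl x y : x + (y - x) = y.
Proof. by rewrite waddC wsubK. Qed.

Lemma wsubww x : x - x = zero_word.
Proof. by rewrite -{1}(wadd0 G x) waddKl. Qed.

Lemma waddB x y z w : (x + y) - (z + w) = (x - z) + (y - w).
Proof. by apply: wsub_eq; rewrite waddACA !wsubK. Qed.

Lemma waddBl x y z : (z + x) - (z + y) = x - y.
Proof. by rewrite waddB wsubww waddC wadd0. Qed.

Lemma wsubBB x y z : (x - z) - (y - z) = x - y.
Proof. by rewrite -(waddBl _ _ z) !wsubKl. Qed.

Lemma wsubDl x y z : (x + y) - z = (x - z) + y.
Proof. by apply: wsub_eq; rewrite -waddA (waddC G y) waddA wsubK. Qed.

Lemma prependD q x y : prepend q (x + y) = prepend q x + shift (size q) y.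
Proof.
elim: q => [|a q IHq] in x y *; first by rewrite !prepend0 shift0.
rewrite -cat1s !prepend_cat IHq (wadd_prepend G) shift_shift.
by rewrite size_cat.
Qed.

Lemma shiftD n x y : shift n (x + y) = shift n x + shift n y.
Proof. by rewrite {1}/shift prependD size_nseq. Qed.

Lemma shiftB n x y : shift n (x - y) = shift n x - shift n y.
Proof. by apply/esym/wsub_eq; rewrite -shiftD wsubK. Qed.

(** If x and y share the prefix q of length m, then x = q x', y = q y' and
    y = x + S^m (y' - x') by the decomposition of words; conversely
    q x' + S^m w = q (x' + w). *)
Lemma agree_addP m x y : agree m x y <-> exists w, y = x + shift m w.
Proof.
split=> [xy|[w ->]].
  exists (tail m y - tail m x).
  rewrite -{1}(prepend_mkseq m y) -{1}(prepend_mkseq m x) (agree_mkseq xy).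
  by rewrite -[X in shift X](size_mkseq y m) -prependD wsubKl.
have := prependD (mkseq x m) (tail m x) w.
rewrite prepend_mkseq size_mkseq => <-; rewrite -{1}(prepend_mkseq m x).
have := @agree_prepend R (mkseq x m) (tail m x) (tail m x + w).
by rewrite size_mkseq.
Qed.

Lemma agreeD m x x' y y' :
  agree m x x' -> agree m y y' -> agree m (x + y) (x' + y').
Proof.
move=> /agree_addP[w ->] /agree_addP[w' ->]; apply/agree_addP.
by exists (w + w'); rewrite shiftD waddACA.
Qed.

Lemma agreeB m x x' y y' :
  agree m x x' -> agree m y y' -> agree m (x - y) (x' - y').
Proof.
move=> /agree_addP[w ->] /agree_addP[w' ->]; apply/agree_addP.
by exists (w - w'); rewrite shiftB waddB.
Qed.

Lemma agree_add2l m x y z : agree m (z + x) (z + y) <-> agree m x y.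
Proof.
split=> [xy|]; last exact: agreeD.
by rewrite -(waddKl z x) -(waddKl z y); exact: agreeB.
Qed.

Lemma agree_sub2r m x y z : agree m (x - z) (y - z) <-> agree m x y.
Proof. by rewrite -(agree_add2l _ _ _ z) !wsubKl. Qed.

Lemma dist_add2l x y z : dist (z + x) (z + y) = dist x y.
Proof. by apply: eq_dist => m; exact: agree_add2l. Qed.

Lemma dist_sub2r x y z : dist (x - z) (y - z) = dist x y.
Proof. by apply: eq_dist => m; exact: agree_sub2r. Qed.

(** The left shift is not additive in general, but it undoes the right shift,
    and the dilatations of coefficient 2^(-p) are only constrained on words of
    x + S^p X. *)
Definition shiftz (e : int) (x : X) : X :=
  match e with Posz n => shift n x | Negz n => tail n.+1 x end.

Definition wball (m : nat) (x : X) : set X := [set y | dist x y <= 2^-1 ^+ m].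

(** V and W are both the ball x + S^p X, which is exactly the image of the
    dilatation of coefficient 2^p. *)
Definition homothety : dilatation R :=
  Dilatation (fun e x y => x + shiftz e (y - x)) wball wball.

Lemma homothetyE p x y : homothety p%:Z x y = x + shift p (y - x).
Proof. by []. Qed.

Lemma homothetyNE p x y : homothety (- p%:Z) x y = x + tail p (y - x).
Proof.
case: p => //; rewrite /= shift0; congr (_ + _).
by apply/funext => i; rewrite /tail addn0.
Qed.

Lemma homothetyK p x u : homothety (- p%:Z) x (homothety p%:Z x u) = u.
Proof. by rewrite homothetyNE homothetyE waddKl shift_tailK wsubKl. Qed.

Lemma homothety_comp p r x u :
  homothety p%:Z x (homothety r%:Z x u) = homothety (p + r)%N%:Z x u.
Proof. by rewrite !homothetyE waddKl shift_shift. Qed.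

Lemma homothetyB p x u v :
  homothety p%:Z x u - homothety p%:Z x v = shift p (u - v).
Proof. by rewrite waddBl -shiftB wsubBB. Qed.

(** Both sides equal x + S^p (y - x) + S^(p+r) (v - y). *)
Lemma homothety_linear p r x y v :
  homothety p%:Z x (homothety r%:Z y v) =
  homothety r%:Z (homothety p%:Z x y) (homothety p%:Z x v).
Proof.
rewrite [RHS]homothetyE homothetyB !homothetyE wsubDl shiftD waddA.
by rewrite !shift_shift addnC.
Qed.

Lemma homothety_dist p x u v :
  dist (homothety p%:Z x u) (homothety p%:Z x v) = 2^-1 ^+ p * dist u v.
Proof. by rewrite !homothetyE dist_add2l dist_shift dist_sub2r. Qed.

Lemma homothety_fix e x : homothety e x x = x.
Proof.
rewrite /= wsubww; have -> : shiftz e zero_word = zero_word.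
  by case: e => n //=; rewrite shift_zero.
by rewrite wadd0.
Qed.

(** The right shifts keep all the common letters, and the left shift by |e|
    drops |e| of them. *)
Lemma homothety_agree (e : int) m x x' y y' :
  agree (m + `|e|%N) x x' -> agree (m + `|e|%N) y y' ->
  agree m (homothety e x y) (homothety e x' y').
Proof.
move=> xx' yy'; apply: agreeD; first by apply: agreeW xx'; rewrite leq_addr.
have := agreeB yy' xx'; case: e {xx' yy'} => n /=; last exact: agree_tail.
by move=> h; apply: (agreeW (leq_addr n m)); apply/agree_shift/agreeW/h/leq_addr.
Qed.

Lemma homothety_near p x y : agree p x (homothety p%:Z x y).
Proof. by apply/agree_addP; exists (y - x). Qed.
Arguments homothety_near : clear implicits.

Lemma homothety_range p x : range (homothety p%:Z x) = wball p x.
Proof.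
apply/seteqP; split=> [_ [y _ <-]|y /= /distP/agree_addP[w ->]].
  exact/distP/homothety_near.
by exists (x + w) => //; rewrite /= waddKl.
Qed.

Lemma homothety_prepend q x y :
  homothety 1 (prepend q x) (prepend q y) = prepend q (homothety 1 x y).
Proof.
have B : prepend q y - prepend q x = shift (size q) (y - x).
  by apply: wsub_eq; rewrite waddC -prependD wsubKl.
by rewrite -[1%R]/(1%N%:Z) !homothetyE B prependD !shift_shift addnC.
Qed.

(** Both (q) and q x are written as q followed by a word; the difference
    x - (q) then turns the tail (q) into x. *)
Lemma homothety_periodic q x : (0 < size q)%N ->
  homothety (size q)%:Z (Defs.periodic q) x = prepend q x.
Proof.
by move=> q0; rewrite homothetyE {1}(periodicE q0) -prependD wsubKl.
Qed.

Lemma homothety_words : induces_words homothety.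
Proof.
by move=> n q x n0; have := @homothety_periodic q x; rewrite size_tuple; exact.
Qed.

Lemma homothety_ifs : induces_ifs homothety.
Proof.
by split=> x; [exact: (@homothety_periodic [:: false])
              |exact: (@homothety_periodic [:: true])].
Qed.

Lemma homothety_self_similar : self_similar homothety.
Proof. by move=> a x y; exact: homothety_prepend. Qed.

Lemma homothety_linear_dilatations : linear_dilatations homothety.
Proof.
move=> p x; split=> [|e y v].
  exists (2^-1 ^+ p) => u v; by rewrite homothety_dist.
case: e => [r _|r]; first exact: homothety_linear.
by rewrite /nu NegzE opprK ltNge -exprnP exprn_ege1 ?ler1n.
Qed.

Lemma wball_open p x : open (wball p x).
Proof.
rewrite openE => y /distP xy; apply/nbhs_agree; exists p => z yz.
exact/distP/(agree_trans xy).
Qed.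

Lemma homothety_continuous e x : continuous (homothety e x).
Proof.
move=> y A /nbhs_agree[m mA]; apply/nbhs_agree.
exists (m + `|e|)%N => z yz; apply: mA; exact: homothety_agree.
Qed.

(** The radius 1 is the diameter, and p1 = 0: any two images under the
    dilatation of coefficient 2^p based at x share p letters with x. *)
Lemma homothetyA0 : axiomA0 homothety 1 0.
Proof.
split=> [p x|p x _|p x|p x _|]; [exact: wball_open|exact: wball_open|..].
- rewrite homothety_range; split=> //; split; first exact: homothety_continuous.
  exists (homothety (- p%:Z) x); first exact: homothetyK.
  apply: continuous_subspaceT; exact: homothety_continuous.
- split=> // [y z|]; last exact: homothetyK.
  rewrite -[domW _ _ _]homothety_range => /set_mem[y' _ <-] /set_mem[z' _ <-].
  by rewrite !homothetyK => ->.
- split=> // p x u v _ _ _ _; apply/distP.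
  apply: (agree_trans (agree_sym (homothety_near p x u))).
  exact: homothety_near.
Qed.

(** The formula makes sense for all e, x and y, and it is continuous on the whole
    product; this gives at once the continuity on the domain and the extension
    to its closure.  At a point of coefficient 2^e this holds because e is
    isolated; at coefficient 0 because delta^x_(2^p) y shares p letters with x. *)
Lemma dil_map_continuous : continuous (dil_map homothety).
Proof.
move=> [[t x] y] A /nbhs_agree[m mA].
have close k (z : X) : nbhs z [set z' | agree k z z'].
  by apply/nbhs_agree; exists k.
case: t => [e|] in mA *.
  exists ([set Some e] `*` [set x' | agree (m + `|e|) x x'],
          [set y' | agree (m + `|e|) y y']).
    split; last exact: close.
    exists ([set Some e], [set x' | agree (m + `|e|) x x']) => //.
    by split; [exact: Gamma0_isolated|exact: close].
  move=> [[t' x'] y'] [/= [-> xx'] yy']; apply: mA => /=.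
  exact: homothety_agree.
(* nu e < 2^(1 - m) means e > m - 1. *)
exists ([set t | @nu0 R t < 2 ^ (1 - m%:Z)] `*` [set x' | agree m x x'], setT).
  split; last exact: filterT.
  exists ([set t | @nu0 R t < 2 ^ (1 - m%:Z)], [set x' | agree m x x']) => //.
  by split; [exact/Gamma0_near0/exprz_gt0|exact: close].
move=> [[[e|] x'] y'] [/= [te xx'] _]; apply: mA => //=.
apply: (agree_trans xx').
move: te; rewrite ltr_eXz2l ?ltr1n // ltrBrDr.
case: e => [p mp|n mn]; last by exfalso; lia.
by apply: (agreeW _ (homothety_near p x' y')); lia.
Qed.

Lemma homothetyA1 : axiomA1 homothety.
Proof.
have ctn := dil_map_continuous.
split=> [|x y|||x y]; first exact: homothety_fix.
- by rewrite -[0%R]/(0%N%:Z) homothetyE shift0 wsubKl.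
- exact: continuous_subspaceT.
- by exists (dil_map homothety) => //; exact: continuous_subspaceT.
- move=> A /nbhs_agree[m mA]; exists m => // p /= mp; apply: mA.
  exact: (agreeW mp (homothety_near p x y)).
Qed.

Lemma homothetyA3 : axiomA3 homothety.
Proof.
exists (fun _ => dist); split=> [|x]; last exact: dist_eq0.
move=> P /uniform_nbhs[E [entE EP]]; exists 0%N => // p _; apply: EP => t _ /=.
rewrite homothety_dist exprVn mulVKf ?expf_neq0 //.
exact: entourage_refl.
Qed.

Lemma homothety_Delta p x u v :
  Delta homothety p x u v = homothety p%:Z x u + (v - u).
Proof. by rewrite /Delta homothetyNE homothetyB shift_tailK. Qed.

Lemma homothetyA4 : axiomA4 homothety 1.
Proof.
exists (fun x u v => x + (v - u)).
move=> P /uniform_nbhs[E [/entourage_agree[m mE] EP]].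
exists m => // p mp; apply: EP => -[[x u] v] _.
have /mE : agree m (x + (v - u)) (Delta homothety p x u v); last exact.
rewrite homothety_Delta; apply: agreeD => //.
exact: (agreeW mp (homothety_near p x u)).
Qed.

Lemma homothety_structure : dilatation_structure homothety.
Proof.
exists 1, 0%N; split; last exact: homothetyA4.
split; [exact: homothetyA0|exact: homothetyA1| |exact: homothetyA3].
exact: homothety_comp.
Qed.

Lemma homothety_properties :
  [/\ dilatation_structure homothety, linear_dilatations homothety,
      self_similar homothety, induces_ifs homothety
    & induces_words homothety].
Proof.
split; [exact: homothety_structure | exact: homothety_linear_dilatations
  | exact: homothety_self_similar | exact: homothety_ifs
  | exact: homothety_words].
Qed.

End WordGroup.

(** * Addition without carries *)

Section PowerSeries.
Context {R : realType}.
Local Notation X := (omega R).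
Implicit Types x y z : X.

Lemma prepend1E a x i : prepend [:: a] x i = if i is j.+1 then x j else a.
Proof. by rewrite /prepend; case: i => [|j] //=; rewrite subn1. Qed.

Definition xor x y : X := fun i => x i (+) y i.

Lemma xorA : associative xor.
Proof. by move=> x y z; apply/funext => i; rewrite /xor addbA. Qed.

Lemma xorC : commutative xor.
Proof. by move=> x y; apply/funext => i; rewrite /xor addbC. Qed.

Lemma xor0 : right_id zero_word xor.
Proof. by move=> x; apply/funext => i; rewrite /xor addbF. Qed.

Lemma xorK x y : xor (xor x y) y = x.
Proof. by apply/funext => i; rewrite /xor addbK. Qed.

Lemma xor_prepend a x y :
  prepend [:: a] (xor x y) = xor (prepend [:: a] x) (shift 1 y).
Proof.
apply/funext => i; rewrite /shift /xor !prepend1E.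
by case: i => [|i] //=; rewrite addbF.
Qed.

Definition power_series : word_group :=
  WordGroup xorA xorC xor0 xorK xorK xor_prepend.

End PowerSeries.

(** * Addition with carries *)

Section Dyadic.
Context {R : realType}.
Local Notation X := (omega R).
Implicit Types (x y z : X) (f : nat -> nat).
Local Open Scope nat_scope.

(** The residue mod 2^n of the 2-adic integer x.  The group laws are checked on
    residues, where they are modular arithmetic. *)
Fixpoint trunc (n : nat) x : nat :=
  if n is m.+1 then trunc m x + x m * 2 ^ m else 0.

Lemma trunc_lt n x : trunc n x < 2 ^ n.
Proof.
elim: n => //= n IHn; rewrite expnS mul2n -addnn -addSn leq_add //.
by rewrite -[leqRHS]mul1n leq_mul2r leq_b1 orbT.
Qed.

Lemma trunc_mod n x : trunc n x %% 2 ^ n = trunc n x.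
Proof. by rewrite modn_small ?trunc_lt. Qed.

Lemma trunc_inj x y : (forall n, trunc n x = trunc n y) -> x = y.
Proof.
move=> xy; apply/funext => i; have /= := xy i.+1; rewrite (xy i) => /addnI/eqP.
by rewrite eqn_pmul2r ?expn_gt0 //; case: (x i); case: (y i).
Qed.

Lemma trunc_prepend n a x : trunc n.+1 (prepend [:: a] x) = a + 2 * trunc n x.
Proof.
elim: n => [|n IHn]; first by rewrite /= prepend1E muln1 muln0 addnC.
rewrite [LHS]/= -/(trunc n.+1 _) IHn prepend1E /= mulnDr expnS.
by rewrite addnA; congr (_ + _); rewrite mulnCA.
Qed.

(** The 2-adic integer whose residue mod 2^n is f n, for a coherent f. *)
Definition digits f : X := fun i => odd (f i.+1 %/ 2 ^ i).

Lemma modn_double m d : 0 < d -> m %% (2 * d) = m %% d + odd (m %/ d) * d.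
Proof.
move=> d0; rewrite {1}(divn_eq m d) -{1}(odd_double_half (m %/ d)).
rewrite mulnDl addnAC addnC -muln2 -mulnA modnMDl addnC modn_small //.
by have := ltn_pmod m d0; case: odd => /=; lia.
Qed.

Lemma trunc_digits f n :
  (forall i, f i.+1 = f i %[mod 2 ^ i]) -> trunc n (digits f) = f n %% 2 ^ n.
Proof.
move=> fP; elim: n => [|n /= ->]; first by rewrite modn1.
by rewrite expnS modn_double ?expn_gt0 // fP.
Qed.

Definition dyadic_add x y : X := digits (fun n => trunc n x + trunc n y).

(** The summand 2^n keeps the difference of residues nonnegative. *)
Definition dyadic_sub x y : X :=
  digits (fun n => trunc n x + (2 ^ n - trunc n y)).

Lemma trunc_add n x y :
  trunc n (dyadic_add x y) = (trunc n x + trunc n y) %% 2 ^ n.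
Proof.
by apply: trunc_digits => i /=; rewrite addnACA -mulnDl addnC modnMDl.
Qed.

Lemma trunc_sub n x y :
  trunc n (dyadic_sub x y) = (trunc n x + (2 ^ n - trunc n y)) %% 2 ^ n.
Proof.
apply: trunc_digits => i /=.
have -> : 2 ^ i.+1 - (trunc i y + y i * 2 ^ i) =
          (2 ^ i - trunc i y) + ~~ y i * 2 ^ i.
  by rewrite expnS; have := trunc_lt i y; case: (y i) => /=; lia.
by rewrite addnACA -mulnDl addnC modnMDl.
Qed.

Lemma dyadic_addA : associative dyadic_add.
Proof.
move=> x y z; apply: trunc_inj => n; rewrite !trunc_add.
by rewrite modnDml modnDmr addnA.
Qed.

Lemma dyadic_addC : commutative dyadic_add.
Proof. by move=> x y; apply: trunc_inj => n; rewrite !trunc_add addnC. Qed.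

Lemma trunc0 n : trunc n zero_word = 0.
Proof. by elim: n => //= n ->. Qed.

Lemma dyadic_add0 : right_id zero_word dyadic_add.
Proof.
by move=> x; apply: trunc_inj => n; rewrite trunc_add trunc0 addn0 trunc_mod.
Qed.

Lemma dyadic_addK x y : dyadic_sub (dyadic_add x y) y = x.
Proof.
apply: trunc_inj => n; rewrite trunc_sub trunc_add modnDml -addnA.
by rewrite subnKC ?modnDr ?trunc_mod // ltnW ?trunc_lt.
Qed.

Lemma dyadic_subK x y : dyadic_add (dyadic_sub x y) y = x.
Proof.
apply: trunc_inj => n; rewrite trunc_add trunc_sub modnDml -addnA.
by rewrite subnK ?modnDr ?trunc_mod // ltnW ?trunc_lt.
Qed.

Lemma dyadic_prepend a x y :
  prepend [:: a] (dyadic_add x y) = dyadic_add (prepend [:: a] x) (shift 1 y).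
Proof.
apply: trunc_inj => -[|n] //; rewrite trunc_add !trunc_prepend trunc_add.
rewrite add0n -addnA -mulnDr {2}(divn_eq (trunc n x + trunc n y) (2 ^ n)).
rewrite mulnDr mulnCA -expnS addnCA modnMDl [RHS]modn_small // expnS.
have : (trunc n x + trunc n y) %% 2 ^ n < 2 ^ n by rewrite ltn_mod expn_gt0.
by case: a => /=; lia.
Qed.

Definition dyadic : word_group :=
  WordGroup dyadic_addA dyadic_addC dyadic_add0 dyadic_addK dyadic_subK
    dyadic_prepend.

Definition one : X := prepend [:: true] zero_word.

(** Adding 2^k flips the letter of index k and carries it to the next one; the
    common prefix of length k is removed first, which reduces the claim to
    k = 0. *)
Lemma dyadic_carry k x : wadd dyadic x (shift k one) k.+1 = x k.+1 (+) x k.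
Proof.
have := prependD dyadic (mkseq x k) (tail k x) one.
rewrite prepend_mkseq size_mkseq => <-.
have := prepend_ge (mkseq x k) (wadd dyadic (tail k x) one) 1.
rewrite size_mkseq => ->.
rewrite /= /dyadic_add /digits /= /tail add1n add0n.
by case: (x k); case: (x k.+1).
Qed.

End Dyadic.

(** * Inequivalence *)

Section Inequivalence.
Context {R : realType}.
Local Notation X := (omega R).

Local Notation D := (homothety (@dyadic R)).
Local Notation D' := (homothety (@power_series R)).

(** The words x = 0101... and u = x + 2^k that separate the two structures. *)
Definition alternating : X := odd.

Definition bumped (k : nat) : X := wadd dyadic alternating (shift k one).

Lemma dyadic_bumped p k : D p%:Z alternating (bumped k) (p + k).+1 = true.
Proof.
rewrite homothetyE waddKl shift_shift dyadic_carry /alternating /=.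
by case: odd.
Qed.

Lemma power_series_bit p i x u :
  D' p%:Z x u (p + i)%N = x (p + i)%N (+) (u i (+) x i).
Proof.
rewrite homothetyE /= /xor /shift; congr addb.
by have := prepend_ge (nseq p false) (xor u x) i; rewrite size_nseq addnC => ->.
Qed.

(** The 2-adic image has the letter 1 at both places, while the letter of the
    other image changes with the parity of p, whatever q is. *)
Lemma bumped_inapproximable p k q :
  D p%:Z alternating (bumped k) (p + k).+1 = D' p%:Z alternating q (p + k).+1 ->
  D p.+1%:Z alternating (bumped k) (p.+1 + k).+1
    = D' p.+1%:Z alternating q (p.+1 + k).+1 -> False.
Proof.
rewrite !dyadic_bumped -!addnS !power_series_bit /alternating addSn /=.
by case: (odd (p + k.+1)); case: (q k.+1 (+) _).
Qed.

Lemma dyadic_power_series_neq : ~ same_dilatations D D'.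
Proof.
by move=> DD'; apply: (@bumped_inapproximable 0 0 (bumped 0)); rewrite DD'.
Qed.

(** On the compact set reduced to (x, u), the uniform limit 0 of 2^p d forces
    the two images to share p+k+2 letters for all large p, in particular for
    two consecutive values of p. *)
Lemma dyadic_not_approximable : ~ approximable (@dist R) D D'.
Proof.
move=> [U [Q [nU]]]; have /nbhs_agree[k kU] := nU alternating.
move/(_ [set (alternating, bumped k)] (@compact_set1 _ _)).
have KU : [set (alternating, bumped k)] `<=` [set t : X * X | U t.1 t.2].
  by move=> _ ->; apply/kU/(agree_addP dyadic); exists one.
move=> /(_ KU); rewrite uniform_set1 /= => /cvgr0_norm_lt.
move=> /(_ (2^-1 ^+ k.+1)); rewrite exprn_gt0 ?invr_gt0 // => /(_ isT)[N _ lt_N].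
have bit p : (N <= p)%N ->
    D p%:Z alternating (bumped k) (p + k).+1 =
    D' p%:Z alternating (Q alternating (bumped k)) (p + k).+1.
  move=> /lt_N /= /(le_lt_trans (ler_norm _)) lt_p.
  have /dist_lt_agree : dist (D p%:Z alternating (bumped k))
      (D' p%:Z alternating (Q alternating (bumped k))) < 2^-1 ^+ (p + k.+1).
    by rewrite exprD exprVn mulrC ltr_pdivlMr ?exprn_gt0 // mulrC.
  by apply; rewrite addnS ltnS.
exact: bumped_inapproximable (bit _ (leqnn N)) (bit _ (leqnSn N)).
Qed.

End Inequivalence.

Theorem proposition6p3 (R : realType) :
  (exists D D' : dilatation R,
    [/\ dilatation_structure D, linear_dilatations D, self_similar D,
        induces_ifs D & induces_words D] /\
    [/\ dilatation_structure D', linear_dilatations D', self_similar D',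
        induces_ifs D' & induces_words D'] /\
    ~ same_dilatations D D') /\
  (exists D D' : dilatation R,
    [/\ dilatation_structure D, linear_dilatations D,
        induces_ifs D & induces_words D] /\
    [/\ dilatation_structure D', linear_dilatations D',
        induces_ifs D' & induces_words D'] /\
    ~ same_dilatations D D' /\
    ~ equivalent_dilatations (@dist R) D (@dist R) D').
Proof.
have neq := @dyadic_power_series_neq R.
split; exists (homothety dyadic), (homothety power_series).
  by split; [|split] => //; exact: homothety_properties.
have [? ? _ ? ?] := homothety_properties (@dyadic R).
have [? ? _ ? ?] := homothety_properties (@power_series R).
by do ![split=> //] => -[_ /dyadic_not_approximable].
Qed.
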